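(* Let $F$ be the class of interior preorder frames and let $S$ be the class of coherent neighbourhood systems. Then the map $$\sigma : F \to S, \qquad (X, \leq, i) \mapsto (X, \leq, N^i), \quad \text{where } N^i_x = \{a \in \mu(X) \mid x \in i(a)\} \text{ for } x \in X,$$ is bijective, and its inverse is given by $$\gamma : S \to F, \qquad (X, \leq, N) \mapsto (X, \leq, i_N), \quad \text{where } i_N(U) = \{x \in X \mid U \in N_x\} \text{ for } U \in \mu(X).$$
   Context: A preordered set $(X, \leq)$ is a set with a reflexive transitive relation. An upset is a subset $U \subseteq X$ such that $x \in U$ and $x \leq y$ imply $y \in U$; $\mu(X)$ is the set of all upsets. $\mu(X)$ is a Heyting algebra under $\cup, \cap, \varnothing, X$ and $a \rhd b = \{x \in X \mid \text{for every } y \in X,\ \text{if } x \leq y \text{ and } y \in a \text{ then } y \in b\}$. For an operator $i : \mu(X) \to \mu(X)$ consider the properties, for all $a, b \in \mu(X)$: $(I_1)$ $i(a) \subseteq a$; $(I_2)$ $i(a) \subseteq i(i(a))$; $(I_3)$ $i(a \cap b) = i(a) \cap i(b)$; $(I_4)$ $i(X) = X$. An interior preorder frame is a triple $(X, \leq, i)$ where $(X,\leq)$ is a preordered set and $i : \mu(X) \to \mu(X)$ satisfies $(I_1)$–$(I_4)$. A neighbourhood space (also called neighbourhood system) is a triple $(X, \leq, N)$ where $(X,\leq)$ is a preordered set and $N : X \to \mathcal{P}(\mu(X))$, $x \mapsto N_x$, satisfies $N_x \subseteq N_y$ whenever $x \leq y$. The operator $i_N$ maps $\mu(X)$ into $\mu(X)$.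 The system is filtered if for every $x \in X$ and $U, V \in \mu(X)$: ($U \in N_x$ and $V \in N_x$) if and only if $U \cap V \in N_x$ (equivalently, $i_N(U) \cap i_N(V) = i_N(U \cap V)$ for all $U, V\in\mu(X)$). A filtered neighbourhood system is coherent if $i_N$ satisfies $(I_1)$ and $(I_2)$.
   Formalization: The class S is restricted to coherent neighbourhood systems in which every N_x is nonempty; without this, taking all N_x empty on a nonempty X gives a coherent system whose i_N violates (I_4), so σ is not surjective. *)

(* Defs.v *)
From mathcomp Require Import all_boot.
From mathcomp Require Import boolp classical_sets functions.

Set Implicit Arguments.
Unset Strict Implicit.
Unset Printing Implicit Defensive.

Local Open Scope classical_set_scope.

Record preordered_set := PreorderedSet {
  carrier :> Type;
  preo : carrier -> carrier -> Prop;
  preo_refl : forall x, preo x x;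
  preo_trans : forall x y z, preo x y -> preo y z -> preo x z
}.

Definition is_upset (X : preordered_set) (U : set X) : Prop :=
  forall x y : X, U x -> preo x y -> U y.

Record upset (X : preordered_set) := Upset {
  upset_set :> set X;
  upset_closed : is_upset upset_set
}.

Lemma is_upsetI (X : preordered_set) (a b : upset X) : is_upset (a `&` b).
Proof.
by move=> x y [ax bx] xy; split; [exact: upset_closed ax xy|exact: upset_closed bx xy].
Qed.

Lemma is_upsetT (X : preordered_set) : @is_upset X setT.
Proof. by []. Qed.

Definition upsetI (X : preordered_set) (a b : upset X) : upset X :=
  Upset (@is_upsetI X a b).

Definition upsetT (X : preordered_set) : upset X := Upset (@is_upsetT X).

Section OperatorProperties.
Variables (X : preordered_set) (i : upset X -> upset X).

Definition I1 := forall a : upset X, i a `<=` a.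
Definition I2 := forall a : upset X, i a `<=` i (i a).
Definition I3 := forall a b : upset X, i (upsetI a b) = upsetI (i a) (i b).
Definition I4 := i (upsetT X) = upsetT X.

End OperatorProperties.

(* A triple (X, <=, i), with no condition on i. *)
Record operator_frame := OperatorFrame {
  of_preo :> preordered_set;
  of_op : upset of_preo -> upset of_preo
}.

Definition interior_preorder_frame : set operator_frame :=
  [set f | [/\ I1 (@of_op f), I2 (@of_op f), I3 (@of_op f) & I4 (@of_op f)]].

Record neighbourhood_space := NeighbourhoodSpace {
  ns_preo :> preordered_set;
  nbh : ns_preo -> set (upset ns_preo);
  nbh_mono : forall x y : ns_preo, preo x y -> nbh x `<=` nbh y
}.

Lemma is_upset_nbh (s : neighbourhood_space) (U : upset s) :
  is_upset [set x : s | nbh x U].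
Proof. by move=> x y /= xU xy; exact: nbh_mono xy _ xU. Qed.

Definition nbh_op (s : neighbourhood_space) (U : upset s) : upset s :=
  Upset (@is_upset_nbh s U).

Definition filtered (s : neighbourhood_space) : Prop :=
  forall (x : s) (U V : upset s), (nbh x U /\ nbh x V) <-> nbh x (upsetI U V).

Definition coherent (s : neighbourhood_space) : Prop :=
  [/\ filtered s, I1 (@nbh_op s) & I2 (@nbh_op s)].

(* [coherent] alone allows nbh x to be empty, in which case I4 fails for
   [nbh_op s] (see [coherent_not_bij] below). As for filters, the families of
   neighbourhoods are therefore required to be nonempty. *)
Definition coherent_system : set neighbourhood_space :=
  [set s | coherent s /\ forall x : s, nbh x !=set0].

Lemma op_nbh_mono (f : operator_frame) (x y : f) :
  preo x y -> [set a : upset f | upset_set (of_op a) x] `<=` [set a | upset_set (of_op a) y].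
Proof. by move=> xy a /= ax; exact: upset_closed ax xy. Qed.

Definition sigma (f : operator_frame) : neighbourhood_space :=
  @NeighbourhoodSpace f (fun x => [set a : upset f | upset_set (of_op a) x]) (@op_nbh_mono f).

Definition gamma (s : neighbourhood_space) : operator_frame :=
  @OperatorFrame s (@nbh_op s).

Lemma coherent_not_bij : ~ set_bij interior_preorder_frame coherent sigma.
Proof.
pose X := @PreorderedSet unit (fun _ _ => True) (fun _ => I) (fun _ _ _ _ _ => I).
pose s := @NeighbourhoodSpace X (fun=> set0) (fun _ _ _ _ => id).
have cs : coherent s by split=> [x U V|U x|U x] //; split=> [[]|].
case=> _ _ /(_ s cs)[f [_ _ _ f4] fs].
have xT : forall x : sigma f, nbh x (upsetT (sigma f)).
  by move=> x; rewrite /nbh /= f4.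
by rewrite fs in xT; exact: (xT tt).
Qed.

(* Main.v *)
Require Import Defs.
From mathcomp Require Import all_boot.
From mathcomp Require Import boolp classical_sets functions.

(** An operator [i] and a system [N] are the same relation between points and upsets, read as [x] in
    [i a] or as [a] in [N x]; upward closure of [i a] is monotonicity of [N]. Hence [sigmaK] and
    [gammaK] are identities between arbitrary structures, and only the axioms remain to be matched:
    [I1] and [I2] carry over verbatim, [I3] is filteredness, and [I4] corresponds to nonempty
    neighbourhood families. *)

Lemma upset_ext (X : preordered_set) (a b : upset X) :
  (forall x, upset_set a x <-> upset_set b x) -> a = b.
Proof.
case: a b => [a aup] [b bup] /= ab.
have e : a = b by apply/funext => x; exact/propext.
by rewrite e in aup *; congr Upset; exact: Prop_irrelevance.
Qed.

(** The two operators have convertible underlying sets; only the proofs of upward closure differ,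
    which [upset_ext] absorbs. *)
Lemma sigmaK (f : operator_frame) : gamma (sigma f) = f.
Proof.
case: f => X i; congr (@OperatorFrame X _).
by apply/funext => a; exact: upset_ext.
Qed.

Lemma gammaK (s : neighbourhood_space) : sigma (gamma s) = s.
Proof.
case: s => X N Nmono.
by congr (@NeighbourhoodSpace X N _); exact: Prop_irrelevance.
Qed.

Lemma sigma_coherent (f : operator_frame) :
  interior_preorder_frame f -> coherent_system (sigma f).
Proof.
(* Rewriting [f] as [gamma (sigma f)] in the hypothesis alone turns [I1] and [I2] into statements
   about [nbh_op (sigma f)]. *)
move=> ipf; have := ipf; rewrite -{1}(sigmaK f) => -[i1 i2 _ _].
case: ipf => _ _ i3 i4; split; first split=> //.
  by move=> x U V; rewrite /nbh /= i3.
by move=> x; exists (upsetT f); rewrite /nbh /= i4.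
Qed.

(** Any neighbourhood [U] is its own intersection with the whole space, so the right-to-left half of
    filteredness yields the whole space. This gives [I4]. *)
Lemma filtered_nbhT (s : neighbourhood_space) (x : s) :
  filtered s -> (nbh x !=set0)%classic -> nbh x (upsetT s).
Proof.
move=> sfilt [U xU]; apply: (proj2 (proj2 (sfilt x U (upsetT s)) _)).
suff -> : upsetI U (upsetT s) = U by [].
by apply: upset_ext => y; split=> [[]|].
Qed.

Lemma gamma_interior (s : neighbourhood_space) :
  coherent_system s -> interior_preorder_frame (gamma s).
Proof.
move=> [[sfilt i1 i2] s0]; split=> //.
  by move=> a b; apply: upset_ext => x; exact: iff_sym (sfilt x a b).
by apply: upset_ext => x; split=> // _; exact: filtered_nbhT.
Qed.

Theorem theorem5p12 :
  [/\ set_bij interior_preorder_frame coherent_system sigma,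
      set_fun coherent_system interior_preorder_frame gamma,
      (forall f : operator_frame, interior_preorder_frame f -> gamma (sigma f) = f)
    & (forall s : neighbourhood_space, coherent_system s -> sigma (gamma s) = s)].
Proof.
split; [split|exact: gamma_interior|by move=> f _; exact: sigmaK
  |by move=> s _; exact: gammaK].
- exact: sigma_coherent.
- by move=> f g _ _ fg; rewrite -(sigmaK f) fg sigmaK.
- by move=> s sS; exists (gamma s); [exact: gamma_interior|exact: gammaK].
Qed.
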